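(* The classes $\mathcal{BDG}$ and $\mathcal{PG}$ are closed under finite direct products. That is, if two groups $G_1$ and $G_2$ are in $\mathcal{BDG}$ (respectively $\mathcal{PG}$), then $G_1\times G_2$ is in $\mathcal{BDG}$ (respectively $\mathcal{PG}$).
   Context: For a group $G=\langle X;R\rangle$ with $X$ finite, let $\Sigma=X\cup X^{-1}$; the word problem of $G$ relative to this presentation is the language $\mathrm{WP}(G:X;R)=\{w\in\Sigma^*: w=1\text{ in }G\}$. $\mathcal{BDC}$ denotes the Boolean closure of the class of deterministic context-free languages: a language over a finite alphabet $\Sigma$ is in $\mathcal{BDC}$ if it belongs to the smallest family of subsets of $\Sigma^*$ containing the deterministic context-free languages over $\Sigma$ and closed under finite union, finite intersection and complement. $\mathcal{PCF}$ denotes the class of poly-context-free languages, i.e. intersections of finitely many context-free languages over the same alphabet. $\mathcal{BDG}$ (respectively $\mathcal{PG}$) is the class of finitely generated groups whose word problem is in $\mathcal{BDC}$ (respectively $\mathcal{PCF}$); this does not depend on the choice of presentation with finite generating set. *)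

(* Defs.v *)
From mathcomp Require Import all_boot.
From mathcomp Require Import boolp classical_sets.
From Stdlib Require Import Relation_Operators.

Set Implicit Arguments.
Unset Strict Implicit.
Unset Printing Implicit Defensive.

Local Open Scope classical_set_scope.

Notation language A := (set (seq A)).

(** * Context-free languages *)

(* In a sentential form, [inl] marks nonterminals and [inr] marks terminals. *)
Record cfg (A : finType) := Cfg {
  nonterminal : finType;
  start_symbol : nonterminal;
  productions : seq (nonterminal * seq (nonterminal + A))
}.

Inductive cfg_step (A : finType) (g : cfg A) :
    seq (nonterminal g + A) -> seq (nonterminal g + A) -> Prop :=
  CfgStep u v N rhs of (N, rhs) \in productions g :
    cfg_step (u ++ inl N :: v) (u ++ rhs ++ v).

Definition cfg_language (A : finType) (g : cfg A) : language A :=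
  [set w | clos_refl_trans _ (cfg_step (g := g))
             [:: inl (start_symbol g)] [seq inr a | a <- w]].

Definition context_free (A : finType) (L : language A) : Prop :=
  exists g : cfg A, L = cfg_language g.

(** * Deterministic context-free languages *)

(* [dpda_trans q (Some a) Z] is the move reading [a] in state [q] with [Z] on
   top of the stack, and [dpda_trans q None Z] the move reading no input. A move
   replaces [Z] by a word of stack symbols; the top of the stack is the head of
   the list, and no move is possible once the stack is empty. *)
Record dpda (A : finType) := Dpda {
  dpda_state : finType;
  dpda_stack : finType;
  dpda_init : dpda_state;
  dpda_bottom : dpda_stack;
  dpda_final : {set dpda_state};
  dpda_trans : dpda_state -> option A -> dpda_stack ->
               option (dpda_state * seq dpda_stack);
  dpda_deterministic : forall q Z, dpda_trans q None Z <> None ->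
                       forall a, dpda_trans q (Some a) Z = None
}.

Definition dpda_config (A : finType) (M : dpda A) : Type :=
  (dpda_state M * seq A * seq (dpda_stack M))%type.

Inductive dpda_step (A : finType) (M : dpda A) :
    dpda_config M -> dpda_config M -> Prop :=
| DpdaRead q a w Z s q' t of dpda_trans q (Some a) Z = Some (q', t) :
    dpda_step (q, a :: w, Z :: s) (q', w, t ++ s)
| DpdaSilent q w Z s q' t of dpda_trans q None Z = Some (q', t) :
    dpda_step (q, w, Z :: s) (q', w, t ++ s).

(* Acceptance by final state; silent moves are allowed after the last letter. *)
Definition dpda_language (A : finType) (M : dpda A) : language A :=
  [set w | exists q s, q \in dpda_final M /\
     clos_refl_trans _ (dpda_step (M := M))
       (dpda_init M, w, [:: dpda_bottom M]) (q, [::], s)].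

Definition det_context_free (A : finType) (L : language A) : Prop :=
  exists M : dpda A, L = dpda_language M.

(** * The classes BDC and PCF *)

Inductive BDC (A : finType) : language A -> Prop :=
| BDC_dcf L of det_context_free L : BDC L
| BDC_union L K of BDC L & BDC K : BDC (L `|` K)
| BDC_inter L K of BDC L & BDC K : BDC (L `&` K)
| BDC_compl L of BDC L : BDC (~` L).

Definition PCF (A : finType) (L : language A) : Prop :=
  exists (n : nat) (K : 'I_n -> language A),
    (forall i, context_free (K i)) /\ L = \bigcap_i K i.

(** * Presentations and word problems *)

(* [(x, false)] stands for the generator [x] and [(x, true)] for its formal
   inverse. *)
Notation letter X := (X * bool)%type.

Definition word_value (G : groupType) (X : Type) (f : X -> G)
    (w : seq (letter X)) : G :=
  (\prod_(a <- w) (if a.2 then (f a.1)^-1 else f a.1))%g.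

(* Equality of words in the group defined by the generators [X] and the
   relators [R], that is, in the free group on [X] modulo the normal closure
   of [R]. *)
Inductive pres_eq (X : Type) (R : set (seq (letter X))) :
    seq (letter X) -> seq (letter X) -> Prop :=
| pres_eq_refl u : pres_eq R u u
| pres_eq_sym u v of pres_eq R u v : pres_eq R v u
| pres_eq_trans u v w of pres_eq R u v & pres_eq R v w : pres_eq R u w
| pres_eq_cancel u v x b : pres_eq R (u ++ [:: (x, b); (x, ~~ b)] ++ v) (u ++ v)
| pres_eq_relator u v r of R r : pres_eq R (u ++ r ++ v) (u ++ v).

(* [G = <X; R>] with [X] finite, [R] being arbitrary; the generators are symbols
   interpreted in [G], and this interpretation need not be injective. *)
Record presentation (G : groupType) := Presentation {
  generator : finType;
  generator_value : generator -> G;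
  relator : set (seq (letter generator));
  presentation_surj : forall g, exists w, word_value generator_value w = g;
  presentation_rel : forall u v,
    word_value generator_value u = word_value generator_value v <->
    pres_eq relator u v
}.

Arguments generator_value {G} p _.

Definition word_problem (G : groupType) (P : presentation G) :
    language (letter (generator P)) :=
  [set w | word_value (generator_value P) w = 1%g].

Arguments word_problem {G} P.

Definition BDG (G : groupType) : Prop :=
  exists P : presentation G, BDC (word_problem P).

Definition PG (G : groupType) : Prop :=
  exists P : presentation G, PCF (word_problem P).

(* Main.v *)
(** Generate [G1 * G2] by the disjoint union of the two generating sets. A word
    over this alphabet is trivial iff erasing the letters of either factor leaves
    a word that is trivial in the other factor, so the word problem of the product
    is the intersection of two inverse images of the given word problems under
    letter-erasing maps. It remains to see that context-free and deterministic
    context-free languages are closed under such inverse images; for Boolean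
    combinations and intersections this then follows formally. *)
Require Import Defs.
From mathcomp Require Import all_boot.
From mathcomp Require Import boolp classical_sets.
From Stdlib Require Import Relation_Operators Operators_Properties.

Set Implicit Arguments.
Unset Strict Implicit.
Unset Printing Implicit Defensive.

Local Open Scope classical_set_scope.

(** * Inverse images of context-free languages *)

Section CfgPreimage.
Variables (A B : finType) (h : B -> option A) (g : cfg A).

Local Notation derives g := (clos_refl_trans _ (@cfg_step _ g)).

Lemma cfg_step_derives (C : finType) (k : cfg C) u v N rhs :
  (N, rhs) \in productions k -> derives k (u ++ inl N :: v) (u ++ rhs ++ v).
Proof. by move=> prod; apply: rt_step; apply: CfgStep. Qed.

Lemma derives_context (C : finType) (k : cfg C) u v x y :
  derives k x y -> derives k (u ++ x ++ v) (u ++ y ++ v).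
Proof.
elim=> {x y} [x y [u' v' N rhs prod]|x|x y z _ xy _ yz].
- by rewrite -!catA !(catA u); apply: cfg_step_derives.
- exact: rt_refl.
- exact: rt_trans xy yz.
Qed.

(* Every symbol [x] of [g] becomes a nonterminal [inl x]; a former terminal [a]
   produces a letter above [a] followed by erased letters. The nonterminal
   [inr false] produces the words of erased letters, and [inr true] is the new
   start symbol. *)
Definition preimage_nonterminal : finType := ((nonterminal g + A) + bool)%type.

Local Notation symbol := (preimage_nonterminal + B)%type.

Definition lift_symbol (x : nonterminal g + A) : symbol := inl (inl x).

Definition erased_symbol : symbol := inl (inr false).

Definition letter_production (c : B) :
    preimage_nonterminal * seq symbol :=
  (if h c is Some a then inl (inr a) else inr false, [:: inr c; erased_symbol]).

Definition preimage_cfg : cfg B :=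
  @Cfg B preimage_nonterminal (inr true)
    ([:: (inr true, [:: erased_symbol; lift_symbol (inl (start_symbol g))]);
         (inr false, [::])]
     ++ [seq letter_production c | c <- enum B]
     ++ [seq (inl (inl p.1), map lift_symbol p.2) | p <- productions g]).

Lemma letter_production_in c : letter_production c \in productions preimage_cfg.
Proof. by rewrite /= !inE mem_cat map_f ?mem_enum ?orbT. Qed.

(** [inr true] goes to the start symbol and [inr false] to the empty word, so that each new
    production projects either to a production of [g] or to an identity. *)
Definition project_symbol (x : symbol) : seq (nonterminal g + A) :=
  match x with
  | inl (inl y) => [:: y]
  | inl (inr b) => if b then [:: inl (start_symbol g)] else [::]
  | inr c => if h c is Some a then [:: inr a] else [::]
  end.

Local Notation project s := (flatten (map project_symbol s)).

Lemma project_terminals w :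
  project [seq inr c | c <- w] = [seq inr a | a <- pmap h w].
Proof. by elim: w => //= c w ->; case: (h c). Qed.

Lemma project_lift s : project (map lift_symbol s) = s.
Proof. by elim: s => //= x s ->. Qed.

Lemma project_derives x y :
  derives preimage_cfg x y -> derives g (project x) (project y).
Proof.
elim=> {x y} [x y [u v N rhs prod]|x|x y z _ xy _ yz].
- rewrite !map_cat !flatten_cat /=; apply: (@derives_context _ g).
  move: prod; rewrite /= !inE !mem_cat.
  case/or4P=> [/eqP[-> ->]|/eqP[-> ->]|/mapP[c _ [-> ->]]|/mapP[p prod [-> ->]]] /=.
  + exact: rt_refl.
  + exact: rt_refl.
  + by case: (h c) => [a|]; apply: rt_refl.
  + rewrite project_lift; case: p prod => N' rhs' /(cfg_step_derives [::] [::]).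
    by rewrite !cats0.
- exact: rt_refl.
- exact: rt_trans xy yz.
Qed.

Lemma lift_derives x y :
  derives g x y -> derives preimage_cfg (map lift_symbol x) (map lift_symbol y).
Proof.
elim=> {x y} [x y [u v N rhs prod]|x|x y z _ xy _ yz].
- rewrite !map_cat /=; apply: (@cfg_step_derives _ preimage_cfg).
  rewrite /= !inE mem_cat; apply/or4P; apply: Or44.
  by apply/mapP; exists (N, rhs).
- exact: rt_refl.
- exact: rt_trans xy yz.
Qed.

(** An [erased_symbol] follows the letters already produced. It produces an erased letter itself, or
    vanishes to let the former terminal [a] produce its letter; either way [letter_production]
    restores it. *)
Lemma derives_preimage_word w :
  derives preimage_cfg
    (erased_symbol :: map lift_symbol [seq inr a | a <- pmap h w])
    [seq inr c | c <- w].
Proof.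
have erase s : derives preimage_cfg (erased_symbol :: s) s.
  have prod : (inr false, [::]) \in productions preimage_cfg by [].
  exact: (cfg_step_derives (k := preimage_cfg) [::] s prod).
elim: w => [|c w IH] /=; first exact: erase.
have := letter_production_in c; rewrite /letter_production.
have IHc := derives_context [:: inr c] [::] IH.
rewrite !cats0 /= in IHc.
case: (h c) => [a|] prod /=.
- apply: (rt_trans _ _ _ _ _ (erase _)); apply: rt_trans IHc.
  exact: (cfg_step_derives (k := preimage_cfg) [::] _ prod).
- apply: rt_trans IHc.
  exact: (cfg_step_derives (k := preimage_cfg) [::] _ prod).
Qed.

Lemma preimage_cfg_language :
  cfg_language preimage_cfg = pmap h @^-1` cfg_language g.
Proof.
apply/seteqP; split=> w /=.
- by move/project_derives; rewrite project_terminals.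
(* The prefix [erased_symbol] matches the right-hand side of the start production. *)
- move/lift_derives/(derives_context (k := preimage_cfg) [:: erased_symbol] [::]).
  rewrite !cats0 /= => der.
  apply: rt_trans (derives_preimage_word w); apply: rt_trans der.
  have start : (inr true, [:: erased_symbol; lift_symbol (inl (start_symbol g))])
      \in productions preimage_cfg by rewrite /= !inE eqxx.
  exact: (cfg_step_derives (k := preimage_cfg) [::] [::] start).
Qed.

End CfgPreimage.

Lemma context_free_preimage (A B : finType) (h : B -> option A) L :
  context_free L -> context_free (pmap h @^-1` L).
Proof. by case=> g ->; exists (preimage_cfg h g); rewrite preimage_cfg_language. Qed.

(** * Inverse images of deterministic context-free languages *)

Section DpdaPreimage.
Variables (A B : finType) (h : B -> option A) (M : dpda A).

Local Notation Q := (dpda_state M).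
Local Notation Gamma := (dpda_stack M).
Local Notation runs M := (clos_refl_trans _ (@dpda_step _ M)).

(* An erased letter must be read although [M] may be about to run silently
   forever, or has emptied its stack. So the simulation pauses, ready to read,
   whenever [M] is in a final state (a silent loop avoiding final states rejects
   every continuation anyway), and the stack gets a bottom marker [None]. A letter
   read at a pause is stored in the state until [M] is able to read it. The
   state [None] only serves to push the initial stack. *)
Definition paused (q : Q) (Z : option Gamma) : bool :=
  (q \in dpda_final M) ||
  (if Z is Some z then ~~ dpda_trans q None z else true).

Definition preimage_move (b : option A) (m : option (Q * seq Gamma)) :
    option (option (Q * option A) * seq (option Gamma)) :=
  omap (fun p => (Some (p.1, b), map some p.2)) m.

Definition preimage_trans (q : option (Q * option A)) (c : option B)
    (Z : option Gamma) :
    option (option (Q * option A) * seq (option Gamma)) :=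
  match q, c, Z with
  | None, None, None =>
      Some (Some (dpda_init M, None), [:: Some (dpda_bottom M); None])
  | Some (q, None), Some c, _ =>
      if paused q Z then Some (Some (q, h c), [:: Z]) else None
  | Some (q, None), None, Some z =>
      if paused q Z then None else preimage_move None (dpda_trans q None z)
  | Some (q, Some a), None, Some z =>
      if dpda_trans q None z is Some p then preimage_move (Some a) (Some p)
      else preimage_move None (dpda_trans q (Some a) z)
  | _, _, _ => None
  end.

Lemma preimage_deterministic q Z : preimage_trans q None Z <> None ->
  forall c, preimage_trans q (Some c) Z = None.
Proof. by case: q => [[q [a|]]|] //; case: Z => //= z; case: (paused q _). Qed.

Definition preimage_dpda : dpda B :=
  @Dpda B (option (Q * option A)) (option Gamma) None None
    [set q | if q is Some (q, None) then q \in dpda_final M else false]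
    preimage_trans preimage_deterministic.

(** * Soundness of the simulating automaton *)

Definition preimage_stack (s : seq Gamma) : seq (option Gamma) :=
  rcons (map some s) None.

Lemma preimage_stack_cat t s :
  preimage_stack (t ++ s) = map some t ++ preimage_stack s.
Proof. by rewrite /preimage_stack map_cat rcons_cat. Qed.

Definition preimage_config (q : Q) (b : option A) (w : seq B) (s : seq Gamma) :
    dpda_config preimage_dpda :=
  (Some (q, b), w, preimage_stack s).

(** A stored letter has left the input of the simulation but not yet that of [M]. *)
Definition unread (b : option A) (w : seq B) : seq A := seq_of_opt b ++ pmap h w.

Lemma unread_cons c w : unread None (c :: w) = unread (h c) w.
Proof. by rewrite /unread /=; case: (h c). Qed.

(** Writing the consumed input as [seq_of_opt o] treats reading and silent moves as one case. *)
Lemma dpda_moveP (C : finType) (K : dpda C) q w S y :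
  @dpda_step _ K (q, w, S) y ->
  exists Z s o w' p, [/\ S = Z :: s, w = seq_of_opt o ++ w',
    dpda_trans q o Z = Some p & y = (p.1, w', p.2 ++ s)].
Proof.
move=> st; inversion st; subst.
- by exists Z, s, (Some a), w0, (q', t).
- by exists Z, s, None, w, (q', t).
Qed.

Lemma dpda_move (C : finType) (K : dpda C) q o Z w s p :
  dpda_trans q o Z = Some p ->
  @dpda_step _ K (q, seq_of_opt o ++ w, Z :: s) (p.1, w, p.2 ++ s).
Proof. by case: o p => [a|] [q' t] tr; [apply: DpdaRead|apply: DpdaSilent]. Qed.

Lemma dpda_read_not_silent (C : finType) (K : dpda C) (q : dpda_state K) a Z p :
  dpda_trans q (Some a) Z = Some p -> dpda_trans q None Z = None.
Proof.
move=> tr; apply: contrapT => silent.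
by rewrite (dpda_deterministic silent) in tr.
Qed.

(** Reading at a pause changes neither [unread] nor the configuration of [M]; every other move
    copies one move of [M]. *)
Lemma preimage_step_sound q b w s x :
  dpda_step (preimage_config q b w s) x ->
  exists q' b' w' s', x = preimage_config q' b' w' s' /\
    runs M (q, unread b w, s) (q', unread b' w', s').
Proof.
case/dpda_moveP=> Z [s0] [o] [w'] [p] [Es -> tr ->] /=.
have pop z s1 : s = z :: s1 -> Z = Some z /\ s0 = preimage_stack s1.
  by move=> E; move: Es; rewrite E /preimage_stack /= => -[-> ->].
have silent o' b' z m : Z = Some z -> dpda_trans q o' z = Some m ->
    Some p = preimage_move b' (Some m) ->
    unread b (seq_of_opt o ++ w') = seq_of_opt o' ++ unread b' w' ->
  exists q' b' w'0 s',
    (p.1, w', p.2 ++ s0) = preimage_config q' b' w'0 s' /\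
    runs M (q, unread b (seq_of_opt o ++ w'), s) (q', unread b' w'0, s').
- move=> Ez trm [->] ->.
  case: s Es pop => [|z1 s1] Es pop; first by move: Es; rewrite Ez.
  have [] := pop _ _ erefl; rewrite Ez => -[<-] -> /=.
  exists m.1, b', w', (m.2 ++ s1); split; last exact/rt_step/dpda_move.
  by rewrite /preimage_config preimage_stack_cat.
move: tr silent; case: b => [a|]; case: o => [c|] //=.
- case: Z Es pop => // z Es pop.
  case tr: (dpda_trans q None z) => [m|] mv silent.
    exact: (silent None _ _ _ erefl tr (esym mv)).
  case tr': (dpda_trans q (Some a) z) mv => [m|] //= mv.
  exact: (silent (Some a) _ _ _ erefl tr' (esym mv)).
- case: ifP => // _ [<-] /= _; rewrite unread_cons -Es.
  by exists q, (h c), w', s; split=> //; apply: rt_refl.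
- case: Z Es pop => // z Es pop; case: ifP => // _.
  case tr: (dpda_trans q None z) => [m|] //= mv silent.
  exact: (silent None _ _ _ erefl tr (esym mv)).
Qed.

Lemma preimage_runs_sound q b w s x :
  runs preimage_dpda (preimage_config q b w s) x ->
  exists q' b' w' s', x = preimage_config q' b' w' s' /\
    runs M (q, unread b w, s) (q', unread b' w', s').
Proof.
move: {1 3}(preimage_config q b w s) (erefl (preimage_config q b w s)) => y Ey.
move=> run; have {}run := clos_rt_rt1n _ _ _ _ run.
elim: run q b w s Ey => {x y} [x|x y z xy _ IH] q b w s Ex.
  by exists q, b, w, s; split=> //; apply: rt_refl.
rewrite Ex in xy; have [q1 [b1 [w1 [s1 [Ey run1]]]]] := preimage_step_sound xy.
have [q2 [b2 [w2 [s2 [Ez run2]]]]] := IH _ _ _ _ Ey.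
by exists q2, b2, w2, s2; split=> //; apply: rt_trans run1 run2.
Qed.

Lemma preimage_dpda_init w :
  dpda_step (dpda_init preimage_dpda, w, [:: dpda_bottom preimage_dpda])
    (preimage_config (dpda_init M) None w [:: dpda_bottom M]).
Proof. exact: (@dpda_move _ preimage_dpda None None None w [::] _ (erefl _)). Qed.

(** * Completeness of the simulating automaton *)

Definition accepts (C : finType) (K : dpda C) (x : dpda_config K) : Prop :=
  exists q s, q \in dpda_final K /\ runs K x (q, [::], s).

Lemma accepts_step (C : finType) (K : dpda C) (x y : dpda_config K) :
  dpda_step x y -> accepts y -> accepts x.
Proof.
by move=> xy [q [s [fin run]]]; exists q, s; split=> //;
  apply: rt_trans run; apply: rt_step.
Qed.

Lemma preimage_move_step q b o b' w z s m :
  preimage_trans (Some (q, b)) o (Some z) = preimage_move b' (Some m) ->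
  dpda_step (preimage_config q b (seq_of_opt o ++ w) (z :: s))
    (preimage_config m.1 b' w (m.2 ++ s)).
Proof.
move=> tr; rewrite /preimage_config preimage_stack_cat.
exact: (@dpda_move _ preimage_dpda _ _ _ _ _ _ tr).
Qed.

(** An empty [s] is covered: [ohead s] is then the bottom marker, which can still be popped and
    pushed back. *)
Lemma preimage_pause_step q c w s :
  paused q (ohead s) ->
  dpda_step (preimage_config q None (c :: w) s) (preimage_config q (h c) w s).
Proof.
move=> pq; have -> : preimage_config q (h c) w s =
    (Some (q, h c), w, [:: ohead s] ++ behead (preimage_stack s)) by case: s pq.
have -> : preimage_config q None (c :: w) s =
    (Some (q, None), c :: w, ohead s :: behead (preimage_stack s)) by case: s pq.
by apply: DpdaRead; rewrite /= pq.
Qed.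

(* While a letter is stored the simulation never pauses, so that case is proved
   first; it is then used for a letter that is read at a pause. *)
Lemma preimage_complete x :
  accepts x -> forall q b w s, x = (q, unread b w, s) ->
  accepts (preimage_config q b w s).
Proof.
case=> qf [sf [fin run]]; have {run} := clos_rt_rt1n _ _ _ _ run.
move Ey: (qf, [::], sf) => y run.
elim: run Ey => {x y} [x|x y z xy yz IH] Ez.
(* [M] has nothing left to read, so [w] consists of erased letters, and the final state allows a
   pause for each. *)
- move=> q [a|] w s; rewrite -Ez /unread //= => -[Eq Ew Es]; subst q s.
  move: Ew; elim: w => [|c w IHw] /=.
    move=> _; exists (Some (qf, None)), (preimage_stack sf).
    by split; [rewrite inE | apply: rt_refl].
  case hc: (h c) => [//|] /= Ew.
  have := @preimage_pause_step qf c w sf; rewrite /paused fin hc => step.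
  exact: accepts_step (step isT) (IHw Ew).
- move: {IH} (IH Ez) => IH.
  have stored q a w s : x = (q, unread (Some a) w, s) ->
      accepts (preimage_config q (Some a) w s).
    move=> Ex; move: xy; rewrite Ex.
    case/dpda_moveP=> Z [s0] [o] [w'] [p] [Es Ew tr Ey]; subst s.
    case: o Ew tr => [a'|] /= Ew tr.
    + case: Ew => ? Ew; subst a'.
      have trN := dpda_read_not_silent tr.
      apply: (@accepts_step _ _ _ (preimage_config p.1 None w (p.2 ++ s0))).
        by apply: (@preimage_move_step _ _ None); rewrite /= trN tr.
      by apply: IH; rewrite Ey /unread Ew.
    + apply: (@accepts_step _ _ _ (preimage_config p.1 (Some a) w (p.2 ++ s0))).
        by apply: (@preimage_move_step _ _ None); rewrite /= tr.
      by apply: IH; rewrite Ey -Ew.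
  move=> q [a|] w s; first exact: stored.
  (* If [q] is final, a pause is possible, so no input is left and acceptance is immediate;
     otherwise the next move of [M] must be silent. *)
  have silent w0 : x = (q, unread None w0, s) ->
      (paused q (ohead s) -> w0 = [::]) -> accepts (preimage_config q None w0 s).
    move=> Ex pw; case fq: (q \in dpda_final M).
      rewrite (pw _) /paused ?fq //.
      exists (Some (q, None)), (preimage_stack s); rewrite inE; split=> //.
      exact: rt_refl.
    move: xy; rewrite Ex; case/dpda_moveP.
    move=> Z [s0] [o] [w'] [p] [Es Ew tr Ey]; subst s.
    have trN : dpda_trans q None Z.
      case pq: (paused q (Some Z)); last by move/negbT: pq; rewrite /paused fq negbK.
      by move: Ew; rewrite (pw pq); case: o tr => //= ->.
    case: o Ew tr => [a'|] /= Ew tr.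
      by rewrite (dpda_read_not_silent tr) in trN.
    apply: (@accepts_step _ _ _ (preimage_config p.1 None w0 (p.2 ++ s0))).
      by apply: (@preimage_move_step _ _ None); rewrite /= /paused fq tr.
    by apply: IH; rewrite Ey -Ew.
  (* A pause uses up a letter without a move of [M], so erased letters need an inner induction with
     [x] fixed. *)
  elim: w => [|c w IHw] Ex; first exact: silent.
  case pq: (paused q (ohead s)); last by apply: silent; rewrite ?pq.
  apply: (accepts_step (preimage_pause_step _ _ pq)); move: Ex; rewrite unread_cons.
  by case: (h c) => [a|]; [apply: stored | apply: IHw].
Qed.

Lemma preimage_dpda_language :
  dpda_language preimage_dpda = pmap h @^-1` dpda_language M.
Proof.
apply/seteqP; split=> w /=.
- case=> q [s [fin run]]; have {}run := clos_rt_rt1n _ _ _ _ run.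
  (* The empty run ends in state [None], which is not final; so the run begins by pushing the
     initial stack. *)
  inversion run as [|y z step rest]; subst; first by move: fin; rewrite inE.
  case/dpda_moveP: step rest => Z [s0] [o] [w'] [p] [[<- <-] -> tr ->].
  case: o tr => //= -[<-] /= rest.
  have {rest} := clos_rt1n_rt _ _ _ _ rest.
  case/(preimage_runs_sound (s := [:: dpda_bottom M])).
  move=> q' [b' [w'' [s' [[Eq Ew Es] run']]]].
  move: fin run'; rewrite Eq inE -Ew; case: b' {Eq} => // fin run'.
  by exists q', s'.
- move=> acc; apply: accepts_step (preimage_dpda_init w) _.
  exact: preimage_complete acc _ None _ _ erefl.
Qed.

End DpdaPreimage.

Lemma det_context_free_preimage (A B : finType) (h : B -> option A) L :
  det_context_free L -> det_context_free (pmap h @^-1` L).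
Proof. by case=> M ->; exists (preimage_dpda h M); rewrite preimage_dpda_language. Qed.

(** * The classes BDC and PCF *)

(** Inverse images commute with the Boolean operations by conversion, so each constructor carries
    over. *)
Lemma BDC_preimage (A B : finType) (h : B -> option A) L :
  BDC L -> BDC (pmap h @^-1` L).
Proof.
elim=> {L} [L dcf|L K _ ? _ ?|L K _ ? _ ?|L _ ?].
- exact/BDC_dcf/det_context_free_preimage.
- exact: BDC_union.
- exact: BDC_inter.
- exact: BDC_compl.
Qed.

Lemma PCF_preimage (A B : finType) (h : B -> option A) L :
  PCF L -> PCF (pmap h @^-1` L).
Proof.
case=> n [K [cfK ->]]; exists n, (fun i => pmap h @^-1` K i); split=> // i.
exact: context_free_preimage.
Qed.

Lemma PCF_inter (A : finType) (L L' : language A) :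
  PCF L -> PCF L' -> PCF (L `&` L').
Proof.
case=> m [K [cfK ->]] [n [K' [cfK' ->]]].
exists (m + n), (fun i => match split i with inl j => K j | inr j => K' j end).
split=> [i|]; first by case: (split i).
apply/seteqP; split=> w.
- by case=> wK wK' i _; case: (split i) => j; [apply: wK | apply: wK'].
- move=> wKK'; split=> j _.
  + by have := wKK' (lshift n j) I; rewrite (unsplitK (inl j)).
  + by have := wKK' (rshift m j) I; rewrite (unsplitK (inr j)).
Qed.

(** * Generators of a direct product *)

Section Words.
Variables (G : groupType) (X : Type) (f : X -> G).

Lemma word_value_cat u v :
  word_value f (u ++ v) = (word_value f u * word_value f v)%g.
Proof. by rewrite /word_value big_cat. Qed.

Lemma word_value_cons a w : word_value f (a :: w) =
  ((if a.2 then (f a.1)^-1 else f a.1) * word_value f w)%g.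
Proof. by rewrite /word_value big_cons. Qed.

Definition inverse_word (w : seq (letter X)) : seq (letter X) :=
  rev [seq (a.1, ~~ a.2) | a <- w].

Lemma inverse_word_cons a w :
  inverse_word (a :: w) = inverse_word w ++ [:: (a.1, ~~ a.2)].
Proof. by rewrite /inverse_word /= rev_cons cats1. Qed.

Lemma word_value_inverse w :
  word_value f (inverse_word w) = ((word_value f w)^-1)%g.
Proof.
elim: w => [|[x b] w IH]; first by rewrite /word_value !big_nil invg1.
rewrite inverse_word_cons word_value_cat IH !word_value_cons invgM /=.
by rewrite [word_value f [::]]/word_value big_nil mulg1; case: b; rewrite /= ?invgK.
Qed.

(** Cancellation starts with the innermost pair. The prefix [u] is built in because [pres_eq] has no
    congruence constructor. *)
Lemma pres_eq_inverse R (u w : seq (letter X)) :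
  pres_eq R (u ++ inverse_word w ++ w) u.
Proof.
elim: w => [|[x b] w IH]; first by rewrite /inverse_word !cats0; apply: pres_eq_refl.
apply: pres_eq_trans IH; rewrite inverse_word_cons -catA /= !(catA u).
by have := pres_eq_cancel R (u ++ inverse_word w) w x (~~ b); rewrite negbK -!catA.
Qed.

(** Any set of relators is allowed; taking all trivial words avoids assembling relators of the
    product from those of the factors. *)
Definition trivial_words : set (seq (letter X)) := [set w | word_value f w = 1%g].

Lemma pres_eq_trivial_words u v :
  word_value f u = word_value f v <-> pres_eq trivial_words u v.
Proof.
split=> [uv|]; last first.
  elim=> {u v} // [u v w _ -> _ ->|u v x b|u v r] //.
  - rewrite !word_value_cat !word_value_cons [word_value f [::]]/word_value big_nil.
    by case: b; rewrite /= mulg1 ?mulVg ?mulgV mul1g.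
  - by rewrite /trivial_words /= !word_value_cat => ->; rewrite mul1g.
(* [u] is equivalent to [u ++ inverse_word v ++ v], whose prefix [u ++ inverse_word v] is a
   relator. *)
apply: pres_eq_trans (pres_eq_sym (pres_eq_inverse _ u v)) _.
have := @pres_eq_relator _ trivial_words [::] v (u ++ inverse_word v).
rewrite /= -catA; apply.
by rewrite /trivial_words /= word_value_cat word_value_inverse uv mulgV.
Qed.

End Words.

(** * The presentation of the direct product *)

Section Product.
Variables (G1 G2 : groupType) (P1 : presentation G1) (P2 : presentation G2).

Local Notation X1 := (generator P1).
Local Notation X2 := (generator P2).
Local Notation X := (X1 + X2)%type.

Definition product_value (x : X) : (G1 * G2)%type :=
  match x with
  | inl x => (generator_value P1 x, 1%g)
  | inr x => (1%g, generator_value P2 x)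
  end.

Definition left_letter (a : letter X) : option (letter X1) :=
  if a is (inl x, b) then Some (x, b) else None.

Definition right_letter (a : letter X) : option (letter X2) :=
  if a is (inr x, b) then Some (x, b) else None.

(** A letter of one factor has value 1 in the other, so erasing it there changes nothing. *)
Lemma product_word_value w : word_value product_value w =
  (word_value (generator_value P1) (pmap left_letter w),
   word_value (generator_value P2) (pmap right_letter w)).
Proof.
elim: w => [|[[x|x] b] w IH]; first by rewrite /word_value !big_nil.
- rewrite !word_value_cons IH.
  by case: b; apply: (f_equal2 pair) => //=; rewrite ?invg1 mul1g.
- rewrite !word_value_cons IH.
  by case: b; apply: (f_equal2 pair) => //=; rewrite ?invg1 mul1g.
Qed.

Lemma product_value_surj g : exists w, word_value product_value w = g.
Proof.
case: g => g1 g2.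
have [w1 <-] := @presentation_surj _ P1 g1.
have [w2 <-] := @presentation_surj _ P2 g2.
exists ([seq (inl a.1, a.2) | a <- w1] ++ [seq (inr a.1, a.2) | a <- w2]).
rewrite product_word_value !pmap_cat.
apply: (f_equal2 pair); congr word_value.
- elim: w1 => [|[x b] w1 /= ->] //=; by elim: w2.
- elim: w1 => [|[x b] w1 /= ->] //=; by elim: w2 => [|[x b] w2 /= ->].
Qed.

Definition product_presentation : presentation (G1 * G2)%type :=
  Presentation product_value_surj (pres_eq_trivial_words product_value).

Lemma word_problem_product :
  word_problem product_presentation =
  (pmap left_letter @^-1` word_problem P1) `&`
  (pmap right_letter @^-1` word_problem P2).
Proof.
apply/seteqP; split=> w; rewrite /word_problem /= product_word_value.
- by case=> -> ->.
- by case=> -> ->.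
Qed.

End Product.

Theorem corollary3p2 (G1 G2 : groupType) :
  (BDG G1 -> BDG G2 -> BDG (G1 * G2)%type) /\
  (PG G1 -> PG G2 -> PG (G1 * G2)%type).
Proof.
split=> -[P1 wp1] [P2 wp2]; exists (product_presentation P1 P2);
  rewrite word_problem_product.
- by apply: BDC_inter; apply: BDC_preimage.
- by apply: PCF_inter; apply: PCF_preimage.
Qed.
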